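(* If $\mathcal A$ and $\mathcal B$ are unital $^*$-algebras over $\mathsf C$ which are formally Morita equivalent, then they are also Morita equivalent as unital $\mathsf C$-algebras, i.e. their categories of (unital) left modules are equivalent.
   Context: $\mathsf R$ is an ordered ring (commutative ring with $1\ne0$ and a subset $\mathsf P$ closed under sums and products such that $\mathsf R$ is the disjoint union $-\mathsf P\cup\{0\}\cup\mathsf P$), and $\mathsf C=\mathsf R(\mathrm i)=\mathsf R\oplus\mathrm i\mathsf R$, $\mathrm i^2=-1$, with the usual conjugation. A $^*$-algebra over $\mathsf C$ is an associative $\mathsf C$-algebra with an antilinear involution satisfying $(AB)^*=B^*A^*$. A linear $\omega:\mathcal A\to\mathsf C$ is positive if $\omega(A^*A)\ge0$ for all $A$; a Hermitian $A$ is positive ($A\ge0$) if $\omega(A)\ge0$ for all positive linear functionals $\omega$. A pre-Hilbert space over $\mathsf C$ is a $\mathsf C$-module with a Hermitian inner product (linear in the second argument), $\langle\phi,\phi\rangle\ge0$, and $\langle\phi,\phi\rangle=0\Rightarrow\phi=0$. A $^*$-representation is a $^*$-homomorphism into the adjointable endomorphisms of a pre-Hilbert space. A $(\mathcal B$-$\mathcal A)$-equivalence bimodule is a $\mathsf C$-module $\mathfrak X$ with commuting left $\mathcal B$- and right $\mathcal A$-actions and maps $\langle\cdot,\cdot\rangle_{\mathcal A}:\mathfrak X\times\mathfrak X\to\mathcal A$, ${}_{\mathcal B}\langle\cdot,\cdot\rangle:\mathfrak X\times\mathfrak X\to\mathcal B$ such that: E1) X1) $\langle\cdot,\cdot\rangle_{\mathcal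 A}$ is $\mathsf C$-linear in the second argument; X2) $\langle x,y\rangle_{\mathcal A}=\langle y,x\rangle_{\mathcal A}^*$; X3) $\langle x,y\cdot A\rangle_{\mathcal A}=\langle x,y\rangle_{\mathcal A}A$; X4) $\langle x,x\rangle_{\mathcal A}\ge0$; X5) $\langle x,B\cdot y\rangle_{\mathcal A}=\langle B^*\cdot x,y\rangle_{\mathcal A}$; X6) the $\mathsf C$-span of all $\langle x,y\rangle_{\mathcal A}$ is $\mathcal A$. E2) Y1) ${}_{\mathcal B}\langle\cdot,\cdot\rangle$ is $\mathsf C$-linear in the first argument; Y2) ${}_{\mathcal B}\langle x,y\rangle={}_{\mathcal B}\langle y,x\rangle^*$; Y3) ${}_{\mathcal B}\langle B\cdot x,y\rangle=B\,{}_{\mathcal B}\langle x,y\rangle$; Y4) ${}_{\mathcal B}\langle x,x\rangle\ge0$; Y5) ${}_{\mathcal B}\langle x\cdot A,y\rangle={}_{\mathcal B}\langle x,y\cdot A^*\rangle$; Y6) the $\mathsf C$-span of all ${}_{\mathcal B}\langle x,y\rangle$ is $\mathcal B$. E3) ${}_{\mathcal B}\langle x,y\rangle\cdot z=x\cdot\langle y,z\rangle_{\mathcal A}$. E4) P): for every $^*$-representation $(\mathfrak H,\pi)$ of $\mathcal A$ the form $\langle x\otimes\psi,y\otimes\phi\rangle=\langle\psi,\pi(\langle x,y\rangle_{\mathcal A})\phi\rangle$ on $\mathfrak X\otimes_{\mathcal A}\mathfrak H$ is positive semi-definite; and Q): P holds for the conjugate $(\mathcal A$-$\mathcal B)$-bimodule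 $\overline{\mathfrak X}$ (conjugate $\mathsf C$-module, $A\bar x=\overline{xA^*}$, $\bar xB=\overline{B^*x}$) with $\langle\bar x,\bar y\rangle_{\mathcal B}={}_{\mathcal B}\langle x,y\rangle$. $\mathcal A$ and $\mathcal B$ are formally Morita equivalent if a $(\mathcal B$-$\mathcal A)$-equivalence bimodule exists. *)

(* Defs.v *)
From HB Require Import structures.
From mathcomp Require Import all_boot all_order all_algebra.
From mathcomp Require Import boolp.
From mathcomp Require Import complex.

Set Implicit Arguments.
Unset Strict Implicit.
Unset Printing Implicit Defensive.

Import Order.TTheory GRing.Theory Num.Theory.
Local Open Scope ring_scope.

(* An ordered ring has no zero divisors and carries an absolute value, so it is
   a [realDomainType].  The library equips [complex R] with a ring structure
   only when [R] is a field; the alias [cplx R] carries it for every ordered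
   ring [R], with the library's multiplication [mulc] and conjugation [conjc]. *)
Definition cplx (R : realDomainType) : Type := complex R.

Section CplxRing.
Variable R : realDomainType.

HB.instance Definition _ := GRing.Zmodule.copy (cplx R) (complex R).

Fact cplx_mul1 :
  left_id (Complex 1 0 : cplx R) (@ComplexField.mulc R : cplx R -> cplx R -> cplx R).
Proof. by move=> [a b] /=; rewrite !mul1r !mul0r subr0 addr0. Qed.

Fact cplx_mulDl :
  left_distributive (@ComplexField.mulc R : cplx R -> cplx R -> cplx R) +%R.
Proof.
move=> [a b] [c d] [e f]; congr Complex; rewrite !mulrDl ?opprD -!addrA.
  by congr (_ + _); rewrite addrCA.
by congr (_ + _); rewrite addrCA.
Qed.

Fact cplx_one_neq0 : (Complex 1 0 : cplx R) != 0.
Proof. by apply/eqP => -[] /eqP; rewrite oner_eq0. Qed.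

HB.instance Definition _ := GRing.Zmodule_isComNzRing.Build (cplx R)
  (@ComplexField.mulcA R) (@ComplexField.mulcC R)
  cplx_mul1 cplx_mulDl cplx_one_neq0.

Definition cconj (z : cplx R) : cplx R := conjc z.

Definition cge0 (z : cplx R) : Prop := complex.Im z = 0 /\ 0 <= complex.Re z.

Lemma cconjD x y : cconj (x + y) = cconj x + cconj y.
Proof. by case: x y => [a b] [c d]; congr Complex; rewrite opprD. Qed.

Lemma cconjM x y : cconj (x * y) = cconj x * cconj y.
Proof.
case: x y => [a b] [c d]; congr Complex; first by rewrite mulrNN.
by rewrite mulrN mulNr opprD.
Qed.

Lemma cconj1 : cconj 1 = 1.
Proof. by congr Complex; rewrite oppr0. Qed.

Lemma cconjK x : cconj (cconj x) = x.
Proof. by case: x => [a b]; rewrite /cconj /= opprK. Qed.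

End CplxRing.

Definition antilinear (R : realDomainType) (U V : lmodType (cplx R))
    (f : U -> V) : Prop :=
  forall c u v, f (c *: u + v) = cconj c *: f u + f v.

(* The library's [algType] would exclude the zero algebra, and it has no
   structure joining [pzRingType] and [lmodType]; so the scalar multiplication
   is part of the mixin, and [alg_mod A] below is [A] as a [cplx R]-module. *)
HB.mixin Record isStarAlgebra (R : realDomainType) A of GRing.PzRing A := {
  ascale : cplx R -> A -> A;
  ascaleA : forall c d a, ascale c (ascale d a) = ascale (c * d) a;
  ascale1 : left_id 1 ascale;
  ascaleDr : right_distributive ascale +%R;
  ascaleDl : forall a, {morph ascale^~ a : c d / c + d};
  ascaleAl : forall c (a b : A), ascale c (a * b) = ascale c a * b;
  ascaleAr : forall c (a b : A), ascale c (a * b) = a * ascale c b;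
  star : A -> A;
  starD : forall a b, star (a + b) = star a + star b;
  starZ : forall c a, star (ascale c a) = ascale (cconj c) (star a);
  starM : forall a b, star (a * b) = star b * star a;
  starK : forall a, star (star a) = a
}.

#[short(type="starAlgType")]
HB.structure Definition StarAlgebra (R : realDomainType) :=
  {A of GRing.PzRing A & isStarAlgebra R A}.

Definition alg_mod (R : realDomainType) (A : starAlgType R) : Type := A.

HB.instance Definition _ (R : realDomainType) (A : starAlgType R) :=
  GRing.Zmodule.on (alg_mod A).
HB.instance Definition _ (R : realDomainType) (A : starAlgType R) :=
  GRing.Zmodule_isLmodule.Build (cplx R) (alg_mod A)
    (@ascaleA R A) (@ascale1 R A) (@ascaleDr R A) (@ascaleDl R A).

Section Positivity.
Variables (R : realDomainType) (A : starAlgType R).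

Definition positive_functional (w : A -> cplx R) : Prop :=
  scalar (w : alg_mod A -> cplx R) /\ forall a, cge0 (w (star a * a)).

Definition alg_ge0 (a : A) : Prop :=
  star a = a /\ forall w, positive_functional w -> cge0 (w a).

End Positivity.

Record preHilbert (R : realDomainType) := PreHilbert {
  ph_space :> lmodType (cplx R);
  inner : ph_space -> ph_space -> cplx R;
  inner_linear : forall phi, scalar (inner phi);
  inner_herm : forall phi psi, inner phi psi = cconj (inner psi phi);
  inner_ge0 : forall phi, cge0 (inner phi phi);
  inner_def : forall phi, inner phi phi = 0 -> phi = 0
}.

Definition is_adjoint (R : realDomainType) (H : preHilbert R)
    (S T : {linear H -> H}) : Prop :=
  forall phi psi, inner (S phi) psi = inner phi (T psi).

(* [pi 1] is not required to be the identity. *)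
Record starRep (R : realDomainType) (A : starAlgType R) (H : preHilbert R) :=
  StarRep {
  rep :> A -> {linear H -> H};
  rep_linear : forall c a b phi, rep (ascale c a + b) phi = c *: rep a phi + rep b phi;
  rep_mul : forall a b phi, rep (a * b) phi = rep a (rep b phi);
  rep_star : forall a, is_adjoint (rep (star a)) (rep a)
}.

(* Units are not required to act as the identity. *)
Record bimodule (R : realDomainType) (B A : starAlgType R) := Bimodule {
  bm_space :> lmodType (cplx R);
  lact : B -> bm_space -> bm_space;
  ract : bm_space -> A -> bm_space;
  lact_linear : forall b, linear (lact b);
  lact_linearl : forall x, linear (fun b : alg_mod B => lact b x);
  lactM : forall b b' x, lact (b * b') x = lact b (lact b' x);
  ract_linear : forall a, linear (fun x => ract x a);
  ract_linearr : forall x, linear (ract x : alg_mod A -> bm_space);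
  ractM : forall x a a', ract x (a * a') = ract (ract x a) a';
  lractA : forall b x a, ract (lact b x) a = lact b (ract x a)
}.

Definition conj_mod (R : realDomainType) (X : lmodType (cplx R)) : Type := X.

Section ConjModule.
Variables (R : realDomainType) (X : lmodType (cplx R)).

HB.instance Definition _ := GRing.Zmodule.on (conj_mod X).

Definition conj_scale (c : cplx R) (x : conj_mod X) : conj_mod X :=
  cconj c *: (x : X).

Fact conj_scaleA c d x : conj_scale c (conj_scale d x) = conj_scale (c * d) x.
Proof. by rewrite /conj_scale scalerA cconjM. Qed.

Fact conj_scale1 : left_id 1 conj_scale.
Proof. by move=> x; rewrite /conj_scale cconj1 scale1r. Qed.

Fact conj_scaleDr : right_distributive conj_scale +%R.
Proof. by move=> c x y; rewrite /conj_scale scalerDr. Qed.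

Fact conj_scaleDl x : {morph conj_scale^~ x : c d / c + d}.
Proof. by move=> c d; rewrite /conj_scale cconjD scalerDl. Qed.

HB.instance Definition _ := GRing.Zmodule_isLmodule.Build (cplx R) (conj_mod X)
  conj_scaleA conj_scale1 conj_scaleDr conj_scaleDl.

End ConjModule.

Section ConjBimodule.
Variables (R : realDomainType) (B A : starAlgType R) (X : bimodule B A).

Let clact (a : A) (x : conj_mod X) : conj_mod X := ract (x : X) (star a).
Let cract (x : conj_mod X) (b : B) : conj_mod X := lact (star b) (x : X).

Fact clact_linear a : linear (clact a).
Proof. by move=> c x y; rewrite /clact; apply: (ract_linear (star a)). Qed.

Fact clact_linearl x : linear (fun a : alg_mod A => clact a x).
Proof.
move=> c a b; rewrite /clact starD starZ.
exact: (ract_linearr (x : X)).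
Qed.

Fact clactM a a' x : clact (a * a') x = clact a (clact a' x).
Proof. by rewrite /clact starM ractM. Qed.

Fact cract_linear b : linear (fun x => cract x b).
Proof. by move=> c x y; rewrite /cract; apply: (lact_linear (star b)). Qed.

Fact cract_linearr x : linear (cract x : alg_mod B -> conj_mod X).
Proof.
move=> c a b; rewrite /cract starD starZ.
exact: (lact_linearl (x : X)).
Qed.

Fact cractM x b b' : cract x (b * b') = cract (cract x b) b'.
Proof. by rewrite /cract starM lactM. Qed.

Fact clractA a x b : cract (clact a x) b = clact a (cract x b).
Proof. by rewrite /cract /clact lractA. Qed.

Definition conj_bimodule : bimodule A B :=
  Bimodule clact_linear clact_linearl clactM
           cract_linear cract_linearr cractM clractA.

End ConjBimodule.

Section Tensor.
Variables (R : realDomainType) (B A : starAlgType R) (X : bimodule B A).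
Variables (H : preHilbert R) (pi : starRep A H).

Record balanced (T : lmodType (cplx R)) (t : X -> H -> T) : Prop := {
  bal_linearl : forall psi, linear (fun x => t x psi);
  bal_linearr : forall x, linear (t x);
  bal_act : forall x a psi, t (ract x a) psi = t x (pi a psi)
}.

Definition is_tensor (T : lmodType (cplx R)) (t : X -> H -> T) : Prop :=
  balanced t /\
  forall (U : lmodType (cplx R)) (s : X -> H -> U), balanced s ->
    exists! f : {linear T -> U}, forall x psi, f (t x psi) = s x psi.

End Tensor.

(* The tensor product is only determined up to isomorphism, so the condition
   ranges over all its models [(T, t)]; [h] is the sesquilinear form on [T]
   with the prescribed values on elementary tensors. *)
Definition tensor_pos (R : realDomainType) (B A : starAlgType R)
    (X : bimodule B A) (ip : X -> X -> A) : Prop :=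
  forall (H : preHilbert R) (pi : starRep A H)
         (T : lmodType (cplx R)) (t : X -> H -> T), is_tensor pi t ->
  forall h : T -> T -> cplx R,
    (forall v, @antilinear R T (cplx R)^o (fun u => h u v)) ->
    (forall u, scalar (h u)) ->
    (forall x y psi phi, h (t x psi) (t y phi) = inner psi (pi (ip x y) phi)) ->
  forall u, cge0 (h u u).

Definition full_ip (R : realDomainType) (X : lmodType (cplx R))
    (A : starAlgType R) (ip : X -> X -> A) : Prop :=
  forall a, exists (n : nat) (c : 'I_n -> cplx R) (x y : 'I_n -> X),
    a = \sum_(i < n) ascale (c i) (ip (x i) (y i)).

Record equivalence_bimodule (R : realDomainType) (B A : starAlgType R) :=
  EquivalenceBimodule {
  eb_bimod :> bimodule B A;
  ipA : eb_bimod -> eb_bimod -> A;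
  ipB : eb_bimod -> eb_bimod -> B;
  ipA_linear : forall x, linear (ipA x : eb_bimod -> alg_mod A);
  ipA_star : forall x y, ipA x y = star (ipA y x);
  ipA_act : forall x y a, ipA x (ract y a) = ipA x y * a;
  ipA_ge0 : forall x, alg_ge0 (ipA x x);
  ipA_adj : forall x y b, ipA x (lact b y) = ipA (lact (star b) x) y;
  ipA_full : full_ip ipA;
  ipB_linear : forall y, linear (fun x => ipB x y : alg_mod B);
  ipB_star : forall x y, ipB x y = star (ipB y x);
  ipB_act : forall b x y, ipB (lact b x) y = b * ipB x y;
  ipB_ge0 : forall x, alg_ge0 (ipB x x);
  ipB_adj : forall x y a, ipB (ract x a) y = ipB x (ract y (star a));
  ipB_full : full_ip ipB;
  ip_compat : forall x y z, lact (ipB x y) z = ract x (ipA y z);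
  eb_P : tensor_pos ipA;
  eb_Q : @tensor_pos R A B (conj_bimodule eb_bimod) ipB
}.

Definition formally_morita_equivalent (R : realDomainType)
    (A B : starAlgType R) : Prop :=
  inhabited (equivalence_bimodule B A).

Record category := Category {
  ob :> Type;
  hom : ob -> ob -> Type;
  idm : forall X, hom X X;
  comp : forall X Y Z, hom Y Z -> hom X Y -> hom X Z;
  comp_idl : forall X Y (f : hom X Y), comp (idm Y) f = f;
  comp_idr : forall X Y (f : hom X Y), comp f (idm X) = f;
  compA : forall X Y Z W (h : hom Z W) (g : hom Y Z) (f : hom X Y),
    comp h (comp g f) = comp (comp h g) f
}.
Arguments idm {c} X.

Record functor (C D : category) := Functor {
  fob :> C -> D;
  fmap : forall X Y : C, hom X Y -> hom (fob X) (fob Y);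
  fmap_id : forall X, fmap (idm X) = idm (fob X);
  fmap_comp : forall X Y Z (g : hom Y Z) (f : hom X Y),
    fmap (comp g f) = comp (fmap g) (fmap f)
}.
Arguments fmap {C D} f0 {X Y}.

Definition id_functor (C : category) : functor C C :=
  @Functor C C id (fun _ _ f => f) (fun=> erefl) (fun _ _ _ _ _ => erefl).

Section CompFunctor.
Variables (C D E : category) (G : functor D E) (F : functor C D).

Fact comp_fmap_id X : fmap G (fmap F (idm X)) = idm (G (F X)).
Proof. by rewrite !fmap_id. Qed.

Fact comp_fmap_comp X Y Z (g : hom Y Z) (f : hom X Y) :
  fmap G (fmap F (comp g f)) = comp (fmap G (fmap F g)) (fmap G (fmap F f)).
Proof. by rewrite !fmap_comp. Qed.

Definition comp_functor : functor C E := Functor comp_fmap_id comp_fmap_comp.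

End CompFunctor.

Definition is_iso (C : category) (X Y : C) (f : hom X Y) : Prop :=
  exists g : hom Y X, comp g f = idm X /\ comp f g = idm Y.

Definition naturally_isomorphic (C D : category) (F G : functor C D) : Prop :=
  exists eta : forall X, hom (F X) (G X),
    (forall X Y (f : hom X Y), comp (eta Y) (fmap F f) = comp (fmap G f) (eta X))
    /\ forall X, is_iso (eta X).

Definition equivalent_categories (C D : category) : Prop :=
  exists (F : functor C D) (G : functor D C),
    naturally_isomorphic (comp_functor G F) (id_functor C) /\
    naturally_isomorphic (comp_functor F G) (id_functor D).

Lemma linear_ext (K : pzRingType) (M N : lmodType K) (f g : {linear M -> N}) :
  f =1 g -> f = g.
Proof.
case: f g => [f [[f0] [f1]]] [g [[g0] [g1]]] /= /funext efg.
by subst g; rewrite (Prop_irrelevance f0 g0) (Prop_irrelevance f1 g1).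
Qed.

Section ModuleCategory.
Variable K : pzRingType.

Definition lin_id (M : lmodType K) : {linear M -> M} := idfun.
Definition lin_comp (M N P : lmodType K) (g : {linear N -> P})
  (f : {linear M -> N}) : {linear M -> P} := g \o f.

Definition lmod_category : category.
Proof.
by apply: (@Category (lmodType K) (fun M N => {linear M -> N}) lin_id lin_comp)
  => *; apply: linear_ext.
Defined.

End ModuleCategory.

(* Compatible scalar multiplication by [cplx R] on an [A]-module is determined by
   [c m = (c 1) m], so left modules over the algebra [A] are left
   modules over its underlying ring. *)
Definition morita_equivalent (R : realDomainType) (A B : starAlgType R) : Prop :=
  equivalent_categories (lmod_category A) (lmod_category B).

(* Main.v *)
From HB Require Import structures.
Require Import Defs.
From mathcomp Require Import all_boot all_order all_algebra.
From mathcomp Require Import boolp.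

(** With [Y] the conjugate of the equivalence bimodule [X], the two inner
    products form a surjective Morita context [Y * X -> A], [X * Y -> B].  The
    functors [M |-> Hom_A(Y, M)] and [N |-> Hom_B(X, N)] are then mutually
    quasi-inverse: writing [1] in [A] as the sum of the [<y_i, x_i>], the map
    [phi |-> \sum_i phi x_i y_i] from [Hom_B(X, Hom_A(Y, M))] to [M] is inverse
    to [m |-> (x |-> y |-> <y, x> m)]. *)

Set Implicit Arguments.
Unset Strict Implicit.
Unset Printing Implicit Defensive.

Import GRing.Theory.
Local Open Scope ring_scope.

(** * Additivity and homogeneity of maps given as plain functions *)

Lemma linear_morphD (K : pzRingType) (U V : lmodType K) (f : U -> V) :
  linear f -> {morph f : x y / x + y}.
Proof. by move=> lf x y; rewrite -[x]scale1r lf !scale1r. Qed.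

Lemma linear_morphZ (K : pzRingType) (U V : lmodType K) (f : U -> V) :
  linear f -> forall c, {morph f : x / c *: x}.
Proof.
move=> lf c x; have f0 : f 0 = 0.
  by apply: (addIr (f 0)); rewrite -(linear_morphD lf) !add0r.
by rewrite -[c *: x]addr0 lf f0 addr0.
Qed.

Lemma morphD_sum (U V : zmodType) (f : U -> V) : {morph f : x y / x + y} ->
  forall (I : Type) (r : seq I) (F : I -> U),
    f (\sum_(i <- r) F i) = \sum_(i <- r) f (F i).
Proof.
move=> fD I r F; apply: big_morph => //.
by apply: (addIr (f 0)); rewrite -fD !add0r.
Qed.

(** * The left [A]-module Hom_B(X, M) *)

Section BimoduleHom.
Variables (R : realDomainType) (B A : starAlgType R) (X : bimodule B A).

Lemma lactDr (b : B) : {morph @lact R B A X b : x y / x + y}.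
Proof. exact: linear_morphD (lact_linear b). Qed.

Lemma lactDl (x : X) : {morph (fun b : B => lact b x) : b c / b + c}.
Proof. exact: linear_morphD (lact_linearl x). Qed.

Lemma ractDl (a : A) : {morph (fun x : X => ract x a) : x y / x + y}.
Proof. exact: linear_morphD (ract_linear a). Qed.

Lemma ractDr (x : X) : {morph (ract x : A -> X) : a c / a + c}.
Proof. exact: linear_morphD (ract_linearr x). Qed.

Definition units_agree : Prop := forall x : X, ract x 1 = lact 1 x.

Definition is_bimod_hom (M : lmodType B) (f : X -> M) : Prop :=
  {morph f : x y / x + y} /\ forall b x, f (lact b x) = b *: f x.

(* Units need not act as the identity on [X], but every homomorphism [f] has
   [f (lact 1 x) = f x]; so [units_agree] is what makes the action of [A] on
   homomorphisms unital.  It is an argument of the carrier so that instance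
   inference can find it. *)
Definition bimod_hom of units_agree := fun M : lmodType B =>
  {f : X -> M | is_bimod_hom f}.

Variables (uX : units_agree) (M : lmodType B).
Local Notation HM := (bimod_hom uX M).

HB.instance Definition _ := gen_eqMixin HM.
HB.instance Definition _ := gen_choiceMixin HM.

Lemma bimod_hom_ext (f g : HM) : sval f =1 sval g -> f = g.
Proof.
by case: f g => [f hf] [g hg] /= /funext fg; subst g; congr exist; apply: Prop_irrelevance.
Qed.

Lemma bimod_hom_unit (f : HM) x : sval f (ract x 1) = sval f x.
Proof. by rewrite uX (svalP f).2 scale1r. Qed.

Fact bimod_hom_zero_subproof : is_bimod_hom (fun _ : X => 0 : M).
Proof. by split=> [x y|b x]; rewrite ?addr0 ?scaler0. Qed.
Definition bimod_hom_zero : HM := exist _ _ bimod_hom_zero_subproof.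

Fact bimod_hom_opp_subproof (f : HM) : is_bimod_hom (fun x => - sval f x).
Proof.
by split=> [x y|b x]; rewrite ?(svalP f).1 ?(svalP f).2 ?opprD ?scalerN.
Qed.
Definition bimod_hom_opp (f : HM) : HM := exist _ _ (bimod_hom_opp_subproof f).

Fact bimod_hom_add_subproof (f g : HM) :
  is_bimod_hom (fun x => sval f x + sval g x).
Proof.
split=> [x y|b x]; first by rewrite (svalP f).1 (svalP g).1 addrACA.
by rewrite (svalP f).2 (svalP g).2 scalerDr.
Qed.
Definition bimod_hom_add (f g : HM) : HM :=
  exist _ _ (bimod_hom_add_subproof f g).

Fact bimod_hom_addA : associative bimod_hom_add.
Proof. by move=> f g h; apply: bimod_hom_ext => x /=; rewrite addrA. Qed.
Fact bimod_hom_addC : commutative bimod_hom_add.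
Proof. by move=> f g; apply: bimod_hom_ext => x /=; rewrite addrC. Qed.
Fact bimod_hom_add0 : left_id bimod_hom_zero bimod_hom_add.
Proof. by move=> f; apply: bimod_hom_ext => x /=; rewrite add0r. Qed.
Fact bimod_hom_addN : left_inverse bimod_hom_zero bimod_hom_opp bimod_hom_add.
Proof. by move=> f; apply: bimod_hom_ext => x /=; rewrite addNr. Qed.

HB.instance Definition _ := GRing.isZmodule.Build HM
  bimod_hom_addA bimod_hom_addC bimod_hom_add0 bimod_hom_addN.

(** The two actions on [X] commute, so precomposing with the right action of [A] preserves
    [B]-linearity; a right action on the source becomes a left action on homomorphisms. *)
Fact bimod_hom_scale_subproof (a : A) (f : HM) :
  is_bimod_hom (fun x => sval f (ract x a)).
Proof.
split=> [x y|b x]; first by rewrite ractDl (svalP f).1.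
by rewrite lractA (svalP f).2.
Qed.
Definition bimod_hom_scale (a : A) (f : HM) : HM :=
  exist _ _ (bimod_hom_scale_subproof a f).

Fact bimod_hom_scaleA a c f :
  bimod_hom_scale a (bimod_hom_scale c f) = bimod_hom_scale (a * c) f.
Proof. by apply: bimod_hom_ext => x /=; rewrite ractM. Qed.
Fact bimod_hom_scale1 : left_id 1 bimod_hom_scale.
Proof. by move=> f; apply: bimod_hom_ext => x /=; apply: bimod_hom_unit. Qed.
Fact bimod_hom_scaleDr : right_distributive bimod_hom_scale +%R.
Proof. by move=> a f g; apply: bimod_hom_ext. Qed.
Fact bimod_hom_scaleDl f : {morph bimod_hom_scale^~ f : a c / a + c}.
Proof.
by move=> a c; apply: bimod_hom_ext => x /=; rewrite ractDr (svalP f).1.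
Qed.

HB.instance Definition _ := GRing.Zmodule_isLmodule.Build A HM
  bimod_hom_scaleA bimod_hom_scale1 bimod_hom_scaleDr bimod_hom_scaleDl.

End BimoduleHom.

(** * The functor Hom_B(X, -) from [B]-modules to [A]-modules *)

Section HomFunctor.
Variables (R : realDomainType) (B A : starAlgType R) (X : bimodule B A).
Variable uX : units_agree X.

Section PostComp.
Variables (M N : lmodType B) (f : {linear M -> N}).

Fact post_comp_subproof (g : bimod_hom uX M) :
  is_bimod_hom (fun x => f (sval g x)).
Proof.
by split=> [x y|b x]; rewrite ?(svalP g).1 ?(svalP g).2 ?linearD ?linearZ.
Qed.

Definition post_comp (g : bimod_hom uX M) : bimod_hom uX N :=
  exist _ _ (post_comp_subproof g).

Fact post_comp_linear : linear post_comp.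
Proof. by move=> a g h; apply: bimod_hom_ext => x /=; rewrite linearD. Qed.

HB.instance Definition _ :=
  GRing.isLinear.Build A (bimod_hom uX M) (bimod_hom uX N) _ post_comp
    post_comp_linear.

End PostComp.

Definition hom_functor : functor (lmod_category B) (lmod_category A).
Proof.
apply: (@Functor (lmod_category B) (lmod_category A)
  (fun M => bimod_hom uX M : lmodType A)
  (fun M N f => post_comp f : {linear _ -> _})).
- by move=> M; apply: linear_ext => g; apply: bimod_hom_ext.
- by move=> M N P f g; apply: linear_ext => h; apply: bimod_hom_ext.
Defined.

End HomFunctor.

(** One half of a surjective Morita context. Fullness is stated at [1] alone: by [pair_lact] the
    sums of values of [p] form a left ideal, so reaching [1] gives all of [A]. *)
Record full_pairing (R : realDomainType) (B A : starAlgType R)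
    (X : bimodule B A) (Y : bimodule A B) (p : Y -> X -> A) : Prop :=
  FullPairing {
  pairDl : forall x, {morph p^~ x : y z / y + z};
  pairDr : forall y, {morph p y : x z / x + z};
  pair_lact : forall a y x, p (lact a y) x = a * p y x;
  pair_ract : forall y x a, p y (ract x a) = p y x * a;
  pair_bal : forall y b x, p (ract y b) x = p y (lact b x);
  pair_full : exists (n : nat) (y : 'I_n -> Y) (x : 'I_n -> X),
    \sum_i p (y i) (x i) = 1
}.

(** * Morita contexts and the equivalence they induce *)

Section MoritaContext.
Variables (R : realDomainType) (B A : starAlgType R).
Variables (X : bimodule B A) (Y : bimodule A B).
Variables (p : Y -> X -> A) (q : X -> Y -> B).
Hypotheses (pP : full_pairing p) (qP : full_pairing q).
Hypothesis qpA : forall x y z, lact (q x y) z = ract x (p y z).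

(** Both units are sums of pairing values, and [qpA] trades a left action by [q] for a right action
    by [p]. Hence 1x is fixed by the right unit and x1 by the left unit, so both equal 1x1. *)
Lemma context_units_agree : units_agree X.
Proof.
move=> x.
have fixA : ract (lact 1 x) 1 = lact 1 x.
  case: (pair_full qP) => n [u [v <-]].
  rewrite (morphD_sum (lactDl x)) (morphD_sum (ractDl 1)).
  by apply: eq_bigr => i _; rewrite qpA -ractM mulr1.
rewrite -fixA lractA; case: (pair_full pP) => n [v [u <-]].
rewrite (morphD_sum (ractDr x)) (morphD_sum (lactDr 1)).
by apply: eq_bigr => i _; rewrite -qpA -lactM mul1r.
Qed.

Hypothesis pqA : forall y x z, lact (p y x) z = ract y (q x z).
Variables (uX : units_agree X) (uY : units_agree Y).

Section CounitInverse.
Variable M : lmodType A.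
Local Notation HYM := (bimod_hom uY M).
Local Notation HXYM := (bimod_hom uX HYM).

Fact pair_hom_subproof (m : M) x : is_bimod_hom (fun y => p y x *: m).
Proof.
split=> [y z|a y]; first by rewrite (pairDl pP) scalerDl.
by rewrite (pair_lact pP) scalerA.
Qed.
Definition pair_hom (m : M) x : HYM := exist _ _ (pair_hom_subproof m x).

Fact counit_inv_subproof (m : M) : is_bimod_hom (pair_hom m).
Proof.
split=> [x z|b x]; apply: bimod_hom_ext => y /=.
  by rewrite (pairDr pP) scalerDl.
by rewrite (pair_bal pP).
Qed.
Definition counit_inv (m : M) : HXYM := exist _ _ (counit_inv_subproof m).

Fact counit_inv_linear : linear counit_inv.
Proof.
move=> a m k; apply: bimod_hom_ext => x; apply: bimod_hom_ext => y /=.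
by rewrite scalerDr scalerA (pair_ract pP).
Qed.
HB.instance Definition _ :=
  GRing.isLinear.Build A M HXYM _ counit_inv counit_inv_linear.

Variables (n : nat) (v : 'I_n -> Y) (u : 'I_n -> X).
Hypothesis pvu : \sum_i p (v i) (u i) = 1.

Definition counit (phi : HXYM) : M := \sum_i sval (sval phi (u i)) (v i).

Lemma counit_invK : cancel counit_inv counit.
Proof. by move=> m; rewrite /counit /= -scaler_suml pvu scale1r. Qed.

Lemma counitK : cancel counit counit_inv.
Proof.
move=> phi; apply: bimod_hom_ext => x; apply: bimod_hom_ext => y /=.
have evalD : {morph (fun x => sval (sval phi x) y) : x z / x + z}.
  by move=> x1 x2; rewrite (svalP phi).1.
(* The value of [phi] at x is its value at x1, even if [1] does not fix x; this lets the
   decomposition [pvu] of [1] enter on the right-hand side. *)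
rewrite /counit scaler_sumr -[sval phi x]bimod_hom_unit -pvu.
rewrite (morphD_sum (ractDr x)) (morphD_sum evalD).
apply: eq_bigr => i _.
(* Both i-th terms equal the value of [phi (u i)] at y acted on by [q x (v i)]: the left one by
   [pqA], the right one by [qpA] and [B]-linearity of [phi]. *)
by rewrite -(svalP (sval phi (u i))).2 pqA -qpA (svalP phi).2.
Qed.

(** The fixed [u i] and [v i] hide the linearity in the defining sum; it is inherited from the
    inverse map. *)
Fact counit_linear : linear counit.
Proof. exact: can2_linear counit_invK counitK. Qed.
Definition counit_lin : {linear HXYM -> M} :=
  HB.pack counit (GRing.isLinear.Build A HXYM M _ counit counit_linear).

End CounitInverse.

Lemma hom_functor_counit :
  naturally_isomorphic (comp_functor (hom_functor uX) (hom_functor uY))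
    (id_functor (lmod_category A)).
Proof.
(* A single decomposition of [1] serves all modules [M]. *)
case: (pair_full pP) => n [v [u pvu]].
exists (fun M => counit_lin M pvu); split.
  move=> M N f; apply: linear_ext => phi /=.
  by rewrite /counit linear_sum.
move=> M; exists (@counit_inv M : {linear _ -> _}); split.
  exact/linear_ext/counitK.
exact/linear_ext/counit_invK.
Qed.

End MoritaContext.

(** The data are symmetric under exchanging [X], [p], [A] with [Y], [q], [B], so the counit
    isomorphism, used twice, handles both composites. *)
Lemma morita_context_equivalence (R : realDomainType) (B A : starAlgType R)
    (X : bimodule B A) (Y : bimodule A B)
    (p : Y -> X -> A) (q : X -> Y -> B) :
  full_pairing p -> full_pairing q ->
  (forall x y z, lact (q x y) z = ract x (p y z)) ->
  (forall y x z, lact (p y x) z = ract y (q x z)) ->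
  morita_equivalent A B.
Proof.
move=> pP qP qpA pqA.
have uX := context_units_agree pP qP qpA.
have uY := context_units_agree qP pP pqA.
exists (hom_functor uY), (hom_functor uX); split.
  exact: (hom_functor_counit pP qpA pqA).
exact: (hom_functor_counit qP pqA qpA).
Qed.

(** * The Morita context of an equivalence bimodule *)

Section EquivalenceBimodule.
Variables (R : realDomainType) (B A : starAlgType R).
Variable X : equivalence_bimodule B A.
Local Notation Y := (conj_bimodule X).

(** On the conjugate module a acts on y as right multiplication by a^*, so the antilinear behaviour
    of [ipA] in its first argument turns into left [A]-linearity. *)
Lemma ipA_full_pairing : @full_pairing R B A X Y (@ipA R B A X).
Proof.
have ipADr x : {morph @ipA R B A X x : y z / y + z}.
  exact: linear_morphD (ipA_linear x).
split=> //.
- by move=> x y z; rewrite ipA_star ipADr starD -!ipA_star.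
- by move=> a y x; rewrite ipA_star ipA_act starM starK -ipA_star.
- exact: ipA_act.
- by move=> y b x; rewrite ipA_adj.
(* The scalars are absorbed into the second argument, where [ipA] is linear. *)
case: (ipA_full X 1) => n [c [x [y ->]]]; exists n, x, (fun i => c i *: y i).
apply: eq_bigr => i _.
exact: (linear_morphZ (ipA_linear (x i))).
Qed.

Lemma ipB_full_pairing : @full_pairing R A B Y X (@ipB R B A X).
Proof.
have ipBDl y : {morph (@ipB R B A X)^~ y : x z / x + z}.
  exact: linear_morphD (ipB_linear y).
split=> //.
- by move=> y x z; rewrite ipB_star ipBDl starD -!ipB_star.
- exact: ipB_act.
- by move=> y x b; rewrite ipB_star ipB_act starM starK -ipB_star.
- by move=> x a y; rewrite ipB_adj.
(* Here the scalars go into the first argument, where [ipB] is linear. *)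
case: (ipB_full X 1) => n [c [x [y ->]]]; exists n, (fun i => c i *: x i), y.
apply: eq_bigr => i _.
exact: (linear_morphZ (ipB_linear (y i))).
Qed.

(** Unfolding the conjugate actions leaves [ip_compat] for z, x, y, read from right to left. *)
Lemma conj_ip_compat (y : Y) (x : X) (z : Y) :
  lact (ipA (y : X) x) z = ract y (ipB x (z : X)).
Proof. by rewrite /= -ipA_star -ipB_star ip_compat. Qed.

End EquivalenceBimodule.

Theorem corollary7p3 (R : realDomainType) (A B : starAlgType R) :
  formally_morita_equivalent A B -> morita_equivalent A B.
Proof.
case=> X.
exact: morita_context_equivalence (ipA_full_pairing X) (ipB_full_pairing X)
  (@ip_compat _ _ _ X) (@conj_ip_compat _ _ _ X).
Qed.
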